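(* Let $\mathbb{F}$ be a field of characteristic different from $2$. If $T\neq S$ are two strictly lower triangular $4\times 4$ matrices with entries in $\mathbb{F}$ such that $T\sim S$, then $T$ and $S$ are equivalent by ETO's, i.e. $T\approx S$.
   Context: Let $\mathbb{F}$ be a field of characteristic different from $2$, and $\mathbb{F}^\times=\mathbb{F}\setminus\{0\}$. For $n\geq 2$, $\mathcal{TM}_n$ denotes the set of all strictly lower triangular $n\times n$ matrices with entries in $\mathbb{F}$. For $T=[t_{ij}]\in\mathcal{TM}_n$, $\mathcal{A}(T)$ is the $\mathbb{F}$-algebra given by generators $X_1,\dots,X_n$ and relations $X_1^2=0$, $X_i^2=\sum_{j<i}t_{ij}X_jX_i$ for $2\leq i\leq n$, and $X_iX_j-X_jX_i=0$ for $1\leq i,j\leq n$; it is a commutative graded algebra with $\deg(X_i)=2$. For $T,S\in\mathcal{TM}_n$ write $T\sim S$ if $\mathcal{A}(T)$ and $\mathcal{A}(S)$ are isomorphic by a degree preserving isomorphism of graded $\mathbb{F}$-algebras. Leader positions: if the $r$-th row of $T$ is nonzero, let $c_r=\max\{j:t_{rj}\neq 0\}$; then $(r,c_r)$ is the leader position of the $r$-th row of $T$. Elementary triangular operations (ETO's) are the following assignments on $T=[t_{rk}]\in\mathcal{TM}_n$, whenever they are well defined: (P) For $1\leq r_1\leq n$ and $\alpha\in\mathbb{F}^\times$, $T\mapsto\mathcal{P}_{r_1}(T,\alpha)=[s_{rk}]$ with $s_{rk}=\alpha^{-1}t_{rk}$ if $r=r_1$, $s_{rk}=\alpha t_{rk}$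 if $k=r_1$, and $s_{rk}=t_{rk}$ otherwise. (F) For $1\leq r_1<r_2\leq n$, if $t_{r_2j}=0$ for each $j\geq r_1$ and $t_{rr_1}=0$ for each $r_1\leq r\leq r_2$, then $T\mapsto\mathcal{F}_{(r_1,r_2)}(T)=[s_{rk}]$ with $s_{rk}=t_{r_2k}$ if $r=r_1$, $s_{rk}=t_{r_1k}$ if $r=r_2$, $s_{rk}=t_{rr_2}$ if $k=r_1$, $s_{rk}=t_{rr_1}$ if $k=r_2$, and $s_{rk}=t_{rk}$ otherwise (rows $r_1,r_2$ and columns $r_1,r_2$ are interchanged). (Q) Let $(r_0,k_0)$ be a leader position of $T$ and $\beta\in\mathbb{F}^\times$. If either $k_0=1$, or $k_0>1$ and $t_{r_0i}+t_{r_0k_0}t_{k_0i}=\beta t_{k_0i}$ for each $1\leq i<k_0$, then $T\mapsto\mathcal{Q}_{(r_0,k_0)}(T,\beta)=[s_{rk}]$ with $s_{r_0k_0}=t_{r_0k_0}-2\beta$, $s_{rk_0}=t_{rk_0}+\beta t_{rr_0}$ for $r>r_0$, and $s_{rk}=t_{rk}$ otherwise. For $T,S\in\mathcal{TM}_n$, one says that $T$ and $S$ are equivalent by ETO's, written $T\approx S$, if there exists a finite sequence of ETO's that transforms $T$ into $S$.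
   Formalization: T ≈ S is read as the equivalence relation generated by ETO's (each may also be undone); with forward sequences only the claim fails for T = 0 and S with single nonzero entry s_21 = 1, since every ETO fixes 0 although T ~ S. *)

(* Defs.v *)
From HB Require Import structures.
From Stdlib Require Import Relation_Operators.
From mathcomp Require Import all_boot all_order all_algebra ring_quotient.
From mathcomp Require Import boolp mpoly.

Set Implicit Arguments.
Unset Strict Implicit.
Unset Printing Implicit Defensive.

Import GRing.Theory.
Local Open Scope ring_scope.
Local Open Scope quotient_scope.

(* Rows, columns and generators are indexed from 0 : the position (r, k) of
   the 1-based convention is (r - 1, k - 1) here. *)
Definition strictly_lower (F : fieldType) (n : nat) (T : 'M[F]_n) : Prop :=
  forall i j : 'I_n, (i <= j)%N -> T i j = 0.

(* The commutation relations are built into {mpoly F[n]}; for the first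
   generator the sum is empty, so that the relator is 'X_0 ^+ 2. *)
Definition relator (F : fieldType) (n : nat) (T : 'M[F]_n) (i : 'I_n) :
    {mpoly F[n]} :=
  'X_i ^+ 2 - \sum_(j < n | (j < i)%N) T i j *: ('X_j * 'X_i).

Definition relations (F : fieldType) (n : nat) (T : 'M[F]_n) :
    {pred {mpoly F[n]}} :=
  fun p => `[< exists h : 'I_n -> {mpoly F[n]},
                 p = \sum_(i < n) h i * relator T i >].

Lemma relationsP (F : fieldType) (n : nat) (T : 'M[F]_n) (p : {mpoly F[n]}) :
  reflect (exists h : 'I_n -> {mpoly F[n]}, p = \sum_(i < n) h i * relator T i)
          (p \in relations T).
Proof. exact: asboolP. Qed.

Lemma relator_at0 (F : fieldType) (n : nat) (T : 'M[F]_n) (i : 'I_n) :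
  (relator T i).@[fun=> 0] = 0.
Proof.
rewrite mevalB expr2 mevalM !mevalXU mulr0 [meval _ _]raddf_sum.
rewrite big1 ?subr0 // => j _.
by rewrite /= mevalZ mevalM !mevalXU !mulr0.
Qed.

Lemma relations_closed (F : fieldType) (n : nat) (T : 'M[F]_n) :
  idealr_closed (relations T).
Proof.
split.
- by apply/relationsP; exists (fun=> 0); rewrite big1 // => i _; rewrite mul0r.
- apply/negP => /relationsP[h /(congr1 (meval (fun=> 0)))].
  rewrite meval1 raddf_sum big1 => [/eqP|i _]; first by rewrite oner_eq0.
  by rewrite /= mevalM relator_at0 mulr0.
move=> a p q /relationsP[h ->] /relationsP[g ->]; apply/relationsP.
exists (fun i => a * h i + g i).
rewrite mulr_sumr -big_split /=; apply: eq_bigr => i _.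
by rewrite mulrDl mulrA.
Qed.

HB.instance Definition _ (F : fieldType) (n : nat) (T : 'M[F]_n) :=
  isIdealr.Build {mpoly F[n]} (relations T) (relations_closed T).

Definition alg (F : fieldType) (n : nat) (T : 'M[F]_n) : Type :=
  {ideal_quot (relations T)}.

HB.instance Definition _ (F : fieldType) (n : nat) (T : 'M[F]_n) :=
  GRing.ComNzRing.on (alg T).

Definition alg_pi (F : fieldType) (n : nat) (T : 'M[F]_n)
    (p : {mpoly F[n]}) : alg T :=
  \pi_({ideal_quot (relations T)}) p.

Lemma alg_piD (F : fieldType) (n : nat) (T : 'M[F]_n) :
  {morph @alg_pi F n T : p q / p + q}.
Proof. exact: (raddfD (\pi_({ideal_quot (relations T)}))). Qed.

Lemma alg_piM (F : fieldType) (n : nat) (T : 'M[F]_n) :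
  {morph @alg_pi F n T : p q / p * q}.
Proof. exact: (rmorphM (\pi_({ideal_quot (relations T)}))). Qed.

Lemma alg_pi1 (F : fieldType) (n : nat) (T : 'M[F]_n) : @alg_pi F n T 1 = 1.
Proof. exact: (rmorph1 (\pi_({ideal_quot (relations T)}))). Qed.

Definition alg_scale (F : fieldType) (n : nat) (T : 'M[F]_n) (a : F)
    (x : alg T) : alg T := alg_pi T a%:MP * x.

Lemma alg_scaleA (F : fieldType) (n : nat) (T : 'M[F]_n) (a b : F)
    (x : alg T) : alg_scale a (alg_scale b x) = alg_scale (a * b) x.
Proof. by rewrite /alg_scale mulrA -alg_piM -mpolyCM. Qed.

Lemma alg_scale1 (F : fieldType) (n : nat) (T : 'M[F]_n) :
  left_id 1 (@alg_scale F n T).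
Proof. by move=> x; rewrite /alg_scale mpolyC1 alg_pi1 mul1r. Qed.

Lemma alg_scaleDr (F : fieldType) (n : nat) (T : 'M[F]_n) :
  right_distributive (@alg_scale F n T) +%R.
Proof. by move=> a x y; rewrite /alg_scale mulrDr. Qed.

Lemma alg_scaleDl (F : fieldType) (n : nat) (T : 'M[F]_n) (x : alg T) :
  {morph (@alg_scale F n T)^~ x : a b / a + b}.
Proof. by move=> a b; rewrite /alg_scale mpolyCD alg_piD mulrDl. Qed.

HB.instance Definition _ (F : fieldType) (n : nat) (T : 'M[F]_n) :=
  GRing.Zmodule_isLmodule.Build F (alg T)
    (@alg_scaleA F n T) (@alg_scale1 F n T) (@alg_scaleDr F n T)
    (@alg_scaleDl F n T).

Lemma alg_scaleAl (F : fieldType) (n : nat) (T : 'M[F]_n) (a : F)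
    (x y : alg T) : a *: (x * y) = (a *: x) * y.
Proof. exact: mulrA. Qed.

HB.instance Definition _ (F : fieldType) (n : nat) (T : 'M[F]_n) :=
  GRing.Lmodule_isLalgebra.Build F (alg T) (@alg_scaleAl F n T).
HB.instance Definition _ (F : fieldType) (n : nat) (T : 'M[F]_n) :=
  GRing.Lalgebra_isComAlgebra.Build F (alg T).

(* The generators have degree 2, hence the factor 2; the component of every
   odd degree is reduced to 0. *)
Definition graded_part (F : fieldType) (n : nat) (T : 'M[F]_n) (d : nat)
    (x : alg T) : Prop :=
  exists2 p : {mpoly F[n]},
    {in msupp p, forall m : 'X_{1..n}, (2 * mdeg m)%N = d} & x = alg_pi T p.

Definition graded_iso (F : fieldType) (n : nat) (T S : 'M[F]_n) : Prop :=
  exists f : {lrmorphism alg T -> alg S},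
    bijective f /\
    forall (d : nat) (x : alg T), graded_part d x -> graded_part d (f x).

Definition leader_position (F : fieldType) (n : nat) (T : 'M[F]_n)
    (r c : 'I_n) : Prop :=
  T r c != 0 /\ forall j : 'I_n, (c < j)%N -> T r j = 0.

Definition etoP (F : fieldType) (n : nat) (r1 : 'I_n) (T : 'M[F]_n) (a : F) :
    'M[F]_n :=
  \matrix_(r, k) if r == r1 then a^-1 * T r k
                 else if k == r1 then a * T r k
                 else T r k.

Definition etoF (F : fieldType) (n : nat) (r1 r2 : 'I_n) (T : 'M[F]_n) :
    'M[F]_n :=
  \matrix_(r, k) if r == r1 then T r2 k
                 else if r == r2 then T r1 k
                 else if k == r1 then T r r2
                 else if k == r2 then T r r1
                 else T r k.

Definition etoQ (F : fieldType) (n : nat) (r0 k0 : 'I_n) (T : 'M[F]_n) (b : F) :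
    'M[F]_n :=
  \matrix_(r, k) if (r == r0) && (k == k0) then T r k - 2%:R * b
                 else if (r0 < r)%N && (k == k0) then T r k + b * T r r0
                 else T r k.

Inductive eto (F : fieldType) (n : nat) (T : 'M[F]_n) : 'M[F]_n -> Prop :=
| EtoP (r1 : 'I_n) (a : F) of
    strictly_lower T & a != 0 : eto T (etoP r1 T a)
| EtoF (r1 r2 : 'I_n) of
    strictly_lower T & (r1 < r2)%N
    & (forall j : 'I_n, (r1 <= j)%N -> T r2 j = 0)
    & (forall r : 'I_n, (r1 <= r <= r2)%N -> T r r1 = 0)
    : eto T (etoF r1 r2 T)
| EtoQ (r0 k0 : 'I_n) (b : F) of
    strictly_lower T & leader_position T r0 k0 & b != 0
    & (k0 = 0%N :> nat \/
       (0 < k0)%N /\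
       forall i : 'I_n, (i < k0)%N -> T r0 i + T r0 k0 * T k0 i = b * T k0 i)
    : eto T (etoQ r0 k0 T b).

(* Operations may be undone: Q with parameter t_{r0 k0} / 2 sends the leader
   entry to 0, so its inverse need not be an operation, and T ~ S does not
   imply that S is reached from T by forward operations only (nothing but 0 is
   reached from 0, although 0 ~ S when S has a single nonzero entry in column
   0). *)
Definition eto_equiv (F : fieldType) (n : nat) (T S : 'M[F]_n) : Prop :=
  clos_refl_sym_trans 'M[F]_n (@eto F n) T S.

(* Main.v *)
Require Import Defs.
From Stdlib Require Import Relation_Operators.
From mathcomp Require Import all_boot all_fingroup all_algebra.
From mathcomp Require Import boolp mpoly zify ring.

(* Let [L_k] be the linear form with [X_k ^+ 2 = L_k X_k] and put
   [D_k = 2 X_k - L_k].  Then [A(T)] is presented by [D_k ^+ 2 = L_k ^+ 2],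
   where [L_k] lies in the span of the [D_j], [j < k].  Over the [D_k], the
   operation (Q) replaces one row [L_r = x D_k + y L_k] by
   [- (y D_k + x L_k)], which has the same square, and changes nothing else,
   while (P) and (F) are conjugations.  If [g] is the degree 2 part of an
   isomorphism, every product [(g(D_i) - g(L_i)) (g(D_i) + g(L_i))] is a
   quadratic relation of the target; comparing the terms in which the last
   variable occurs shows that, after operations (Q), (F) and (P) on the source,
   [g] fixes that variable, and by descending induction [g] becomes the
   identity.  Both algebras then have the same squares [L_k ^+ 2] modulo the
   earlier relations.  In size 4 this leaves, for the rows [(s)], [(b, c)],
   [(x, y, z)], the invariants [b c], [x y + b c z ^+ 2], [x z], [y z]; rows
   with equal invariants are linked by operations (P) and (Q) that change the
   earlier rows only temporarily. *)

Set Implicit Arguments.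
Unset Strict Implicit.
Unset Printing Implicit Defensive.

Import GRing.Theory.
Local Open Scope ring_scope.

(** * Coordinates of the forms [L_k] over the [X_k] and over the [D_k] *)

Lemma strictly_lower_unit (F : fieldType) (n : nat) (c : F) (N : 'M[F]_n) :
  c != 0 -> strictly_lower N -> c%:M + N \in unitmx.
Proof.
move=> c0 lowN; rewrite unitmxE det_trig; last first.
  apply/is_trig_mxP => i j ij.
  by rewrite !mxE lowN ?(ltnW ij) // addr0 -val_eqE ltn_eqF.
under eq_bigr => i _ do rewrite !mxE eqxx mulr1n lowN // addr0.
by rewrite prodr_const unitrX // unitfE.
Qed.

(** Induction from the last column backwards: the entry [(i, j)] of [Y] is [c * X i j] plus terms
    [X i k * N k j] with [k > j], where [X i k] is already known to vanish. *)
Lemma strictly_lower_div (F : fieldType) (n : nat) (c : F) (X N Y : 'M[F]_n) :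
  c != 0 -> strictly_lower N -> strictly_lower Y -> X *m (c%:M + N) = Y ->
  strictly_lower X.
Proof.
move=> c0 lowN lowY XY i j.
have [d] := ubnP (n - j); elim: d j => // d IHd j jd ij.
have /matrixP/(_ i j) := XY; rewrite [Y i j]lowY // mulmxDr mul_mx_scalar !mxE.
rewrite big1 ?addr0 => [|k _].
  by move/eqP; rewrite mulf_eq0 (negPf c0) => /eqP.
have [kj|jk] := leqP k j; first by rewrite lowN ?mulr0.
rewrite IHd ?mul0r ?(leq_trans ij (ltnW jk)) //.
by apply: leq_trans (jd : (n - j <= d)%N); rewrite ltn_sub2l.
Qed.

(* When the rows of [L] are the coordinates of the forms [L_k] over the [D_k],
   those of [tri L] are their coordinates over the [X_k]. *)
Definition tri (F : fieldType) (n : nat) (L : 'M[F]_n) : 'M[F]_n :=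
  2%:R *: L *m invmx (1%:M + L).

Lemma tri_eq (F : fieldType) (n : nat) (L T : 'M[F]_n) :
  strictly_lower L -> T *m (1%:M + L) = 2%:R *: L -> T = tri L.
Proof.
move=> lowL TL; rewrite /tri -TL mulmxK //.
by apply: strictly_lower_unit; rewrite ?oner_eq0.
Qed.

Lemma triK (F : fieldType) (n : nat) (L : 'M[F]_n) :
  strictly_lower L -> tri L *m (1%:M + L) = 2%:R *: L.
Proof.
by move=> lowL; rewrite /tri mulmxKV // strictly_lower_unit ?oner_eq0.
Qed.

Lemma strictly_lower_tri (F : fieldType) (n : nat) (L : 'M[F]_n) :
  strictly_lower L -> strictly_lower (tri L).
Proof.
move=> lowL; apply: (strictly_lower_div (oner_neq0 F) lowL _ (triK lowL)).
by move=> i j ij; rewrite mxE lowL ?mulr0.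
Qed.

(** * The operations (P), (F), (Q) in the coordinates over the [D_k] *)

Definition leqv (F : fieldType) (n : nat) (L L' : 'M[F]_n) : Prop :=
  eto_equiv (tri L) (tri L').

Lemma leqv_refl (F : fieldType) (n : nat) (L : 'M[F]_n) : leqv L L.
Proof. exact: rst_refl. Qed.

Lemma leqv_sym (F : fieldType) (n : nat) (L L' : 'M[F]_n) :
  leqv L L' -> leqv L' L.
Proof. exact: rst_sym. Qed.

Lemma leqv_trans (F : fieldType) (n : nat) (L1 L2 L3 : 'M[F]_n) :
  leqv L1 L2 -> leqv L2 L3 -> leqv L1 L3.
Proof. exact: rst_trans. Qed.

(** [tri L] is a rational expression in [L], hence is conjugated along with [L]; (P) and (F) are
    transported in this way. *)
Lemma tri_conj (F : fieldType) (n : nat) (U L L' : 'M[F]_n) :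
  U \in unitmx -> strictly_lower L -> strictly_lower L' ->
  U *m L = L' *m U -> U *m tri L = tri L' *m U.
Proof.
move=> uU lowL lowL' UL.
have E : U *m tri L *m invmx U = tri L'.
  apply: tri_eq => //.
  have UVL : invmx U *m (1%:M + L') = (1%:M + L) *m invmx U.
    rewrite mulmxDr mulmxDl mulmx1 mul1mx -[L'](mulmxK uU) -UL.
    by rewrite !mulmxA mulVmx ?mul1mx.
  rewrite -mulmxA UVL mulmxA -(mulmxA U) triK //.
  by rewrite -scalemxAr -scalemxAl UL mulmxK.
by rewrite -E mulmxKV.
Qed.

(* For [b = x + y], the row [x D_k + y L_k] becomes [- (y D_k + x L_k)]. *)
Definition rowQ (F : fieldType) (n : nat) (r k : 'I_n) (b : F) (L : 'M[F]_n) :=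
  L - b *: (delta_mx r k *m (1%:M + L)).

Lemma strictly_lower_rowQ (F : fieldType) (n : nat) (r k : 'I_n) (b : F)
    (L : 'M[F]_n) :
  (k < r)%N -> strictly_lower L -> strictly_lower (rowQ r k b L).
Proof.
move=> kr lowL i j ij; rewrite /rowQ mulmxDr mulmx1 !mxE lowL // sub0r.
rewrite (bigD1 k) //= big1 ?addr0 => [|l lk]; last first.
  by rewrite mxE (negPf lk) andbF mul0r.
rewrite !mxE eqxx andbT; have [ir|] := eqVneq i r; last first.
  by rewrite /= mul0r add0r mulr0 oppr0.
have kj : (k < j)%N by rewrite (leq_trans kr) // -ir.
by rewrite lowL ?(ltnW kj) // mulr0 addr0 -val_eqE gtn_eqF //= mulr0 oppr0.
Qed.

Lemma etoQ_mx (F : fieldType) (n : nat) (r k : 'I_n) (b : F) (T : 'M[F]_n) :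
  strictly_lower T ->
  etoQ r k T b = T + b *: (T *m delta_mx r k) - (2%:R * b) *: delta_mx r k.
Proof.
move=> lowT; apply/matrixP => i j; rewrite !mxE (bigD1 r) //=.
rewrite big1 ?addr0; last first.
  move=> l lr; by rewrite mxE (negPf lr) mulr0.
rewrite !mxE eqxx /=; have [->|jk] /= := eqVneq j k; last first.
  by rewrite !andbF !mulr0n !mulr0 addr0 subr0.
rewrite !andbT mulr1n mulr1; have [->|ir] /= := eqVneq i r.
  by rewrite (lowT r r) // mulr0 addr0 mulr1.
have [ri|ir'] := ltnP r i; first by rewrite mulr0 subr0.
by rewrite (lowT i r) // !mulr0 addr0 subr0.
Qed.

(** Put [E = delta_mx r k], so that [E *m E = 0]. Then [1 + rowQ r k b L = (1 - b E) (1 + L)], while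
    [etoQ r k T b] times [1 - b E] is [T - 2 b E]; the equation that characterises [tri] follows. *)
Lemma tri_rowQ (F : fieldType) (n : nat) (r k : 'I_n) (b : F) (L : 'M[F]_n) :
  (k < r)%N -> strictly_lower L -> etoQ r k (tri L) b = tri (rowQ r k b L).
Proof.
move=> kr lowL; apply: tri_eq; first exact: strictly_lower_rowQ.
rewrite etoQ_mx; last exact: strictly_lower_tri.
have -> : 1%:M + rowQ r k b L = (1%:M - b *: delta_mx r k) *m (1%:M + L).
  by rewrite mulmxBl mul1mx -scalemxAl addrA.
have EE : delta_mx r k *m delta_mx r k = 0 :> 'M[F]_n.
  by rewrite mul_delta_mx_0 // -val_eqE ltn_eqF.
rewrite mulmxA.
have -> : (tri L + b *: (tri L *m delta_mx r k) - (2%:R * b) *: delta_mx r k) *m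
   (1%:M - b *: delta_mx r k) = tri L - (2%:R * b) *: delta_mx r k.
  rewrite mulmxBr mulmx1 -scalemxAr !mulmxBl mulmxDl -!scalemxAl.
  rewrite -(mulmxA (tri L) (delta_mx r k)) EE mulmx0 !scaler0 addr0 subr0.
  by rewrite addrAC addrK.
by rewrite mulmxBl triK // -scalemxAl /rowQ scalerBr scalerA.
Qed.

Lemma mul_delta_mxE (F : fieldType) (n p : nat) (r k : 'I_n) (X : 'M[F]_(n, p))
    (i : 'I_n) (j : 'I_p) :
  (delta_mx r k *m X) i j = (i == r)%:R * X k j.
Proof.
rewrite mxE (bigD1 k) //= big1 ?addr0 => [|l lk]; last first.
  by rewrite mxE (negPf lk) andbF mul0r.
by rewrite mxE eqxx andbT.
Qed.

Lemma rowQE (F : fieldType) (n : nat) (r k : 'I_n) (b : F) (L : 'M[F]_n)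
    (i j : 'I_n) :
  rowQ r k b L i j =
    if i == r then L r j - b * ((j == k)%:R + L k j) else L i j.
Proof.
rewrite /rowQ [LHS]mxE [X in _ + X]mxE [X in _ - X]mxE.
rewrite mul_delta_mxE !mxE (eq_sym k).
case: eqP => [->|_]; first by rewrite mul1r.
by rewrite mul0r mulr0 subr0.
Qed.

Lemma rowQK (F : fieldType) (n : nat) (r k : 'I_n) (b : F) (L : 'M[F]_n) :
  (k < r)%N -> rowQ r k (- b) (rowQ r k b L) = L.
Proof.
move=> kr; have kNr : k == r = false by rewrite -val_eqE ltn_eqF.
apply/matrixP => i j; rewrite !rowQE eqxx kNr.
by case: eqP => // ->; rewrite mulNr opprK subrK.
Qed.

(** Substitute [D_k = 2 X_k - L_k] in [x D_k + y L_k]. The result has the shape that the hypothesis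
    of (Q) asks for, with parameter [x + y]. *)
Lemma tri_row (F : fieldType) (n : nat) (r k : 'I_n) (x y : F) (L : 'M[F]_n) :
  strictly_lower L ->
  (forall j, L r j = x * (j == k)%:R + y * L k j) ->
  forall j, tri L r j = 2%:R * x * (j == k)%:R + (y - x) * tri L k j.
Proof.
move=> lowL Lr j.
have TL i : row i (tri L) *m (1%:M + L) = 2%:R *: row i L.
  by rewrite -row_mul triK // linearZ.
suff /rowP/(_ j) : row r (tri L) =
    (2%:R * x) *: delta_mx 0 k + (y - x) *: row k (tri L).
  by rewrite !mxE eqxx.
have uL : 1%:M + L \in unitmx by rewrite strictly_lower_unit ?oner_eq0.
apply: (can_inj (mulmxK uL)).
rewrite TL mulmxDl -!scalemxAl TL mulmxDr mulmx1 -rowE.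
by apply/rowP => l; rewrite !mxE Lr eqxx /=; ring.
Qed.

(** (Q) needs a nonzero leader, hence [x != 0]. A row [y L_k] is treated backwards: its image
    [- y D_k] has leader coefficient [- y], and (Q) sends it back. *)
Lemma leqv_Q (F : fieldType) (n : nat) (r k : 'I_n) (x y : F) (L : 'M[F]_n) :
  2%:R != 0 :> F -> (k < r)%N -> strictly_lower L ->
  (forall j, L r j = x * (j == k)%:R + y * L k j) ->
  leqv L (rowQ r k (x + y) L).
Proof.
move=> two0 kr; have kNr : k == r = false by rewrite -val_eqE ltn_eqF.
have Qleader (z t : F) (N : 'M[F]_n) : strictly_lower N -> z != 0 ->
    (forall j, N r j = z * (j == k)%:R + t * N k j) ->
    leqv N (rowQ r k (z + t) N).
  move=> lowN z0 Nr; have [->|b0] := eqVneq (z + t) 0.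
    suff -> : rowQ r k 0 N = N by exact: leqv_refl.
    by rewrite /rowQ scale0r subr0.
  have lowT := strictly_lower_tri lowN.
  have Tr := tri_row lowN Nr.
  rewrite /leqv -tri_rowQ //; apply: rst_step; apply: EtoQ => //.
    split=> [|j kj]; rewrite Tr.
      by rewrite eqxx mulr1 lowT // mulr0 addr0 mulf_neq0.
    by rewrite lowT ?(ltnW kj) // -val_eqE gtn_eqF // !mulr0 addr0.
  have [k0|k0] := posnP k; [by left | right; split=> // i ik].
  rewrite !Tr eqxx (lowT k k) // -val_eqE ltn_eqF //=; ring.
move=> lowL Lr; have [x0|] := eqVneq x 0; last by move=> x0; apply: Qleader.
have [y0|y0] := eqVneq y 0.
  suff -> : rowQ r k (x + y) L = L by exact: leqv_refl.
  by rewrite /rowQ x0 y0 addr0 scale0r subr0.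
apply: leqv_sym; rewrite -[X in leqv _ X](rowQK (x + y) L kr).
rewrite x0 add0r -[- y]addr0; apply: Qleader.
- exact: strictly_lower_rowQ.
- by rewrite oppr_eq0.
by move=> j; rewrite !rowQE eqxx kNr Lr x0; ring.
Qed.

Definition scale_mx (F : fieldType) (n : nat) (r : 'I_n) (a : F) : 'M[F]_n :=
  diag_mx (\row_i (if i == r then a^-1 else 1)).

Lemma scale_mx_unit (F : fieldType) (n : nat) (r : 'I_n) (a : F) :
  a != 0 -> scale_mx r a \in unitmx.
Proof.
move=> a0; rewrite unitmxE det_diag unitfE; apply/prodf_neq0 => i _.
by rewrite mxE; case: (i == r); rewrite ?invr_eq0 ?oner_eq0.
Qed.

Lemma etoP_conj (F : fieldType) (n : nat) (r : 'I_n) (a : F) (N : 'M[F]_n) :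
  a != 0 -> strictly_lower N ->
  scale_mx r a *m N = etoP r N a *m scale_mx r a.
Proof.
move=> a0 lowN; rewrite mul_diag_mx mul_mx_diag; apply/matrixP => i j.
rewrite !mxE; have [->|_] := eqVneq i r; have [->|_] := eqVneq j r.
- by rewrite lowN // !(mulr0, mul0r).
- by rewrite mulr1.
- by rewrite mul1r mulrC mulKf.
- by rewrite mul1r mulr1.
Qed.

Lemma strictly_lower_etoP (F : fieldType) (n : nat) (r : 'I_n) (a : F)
    (N : 'M[F]_n) :
  strictly_lower N -> strictly_lower (etoP r N a).
Proof. by move=> lowN i j ij; rewrite mxE lowN // !mulr0 !if_same. Qed.

Lemma leqv_P (F : fieldType) (n : nat) (r : 'I_n) (a : F) (L : 'M[F]_n) :
  a != 0 -> strictly_lower L -> leqv L (etoP r L a).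
Proof.
move=> a0 lowL; have uU := scale_mx_unit r a0.
have lowP := strictly_lower_etoP r a lowL.
have lowT := strictly_lower_tri lowL.
suff E : etoP r (tri L) a = tri (etoP r L a).
  by rewrite /leqv -E; apply: rst_step; apply: EtoP.
apply: (can_inj (mulmxK uU)); rewrite -etoP_conj //.
by rewrite (tri_conj uU lowL lowP) // etoP_conj.
Qed.

(** (F) exchanges the two rows without permuting the entries inside them; this agrees with
    conjugation by the transposition because the block on the indices [r1], [r2] is zero. *)
Lemma etoFE (F : fieldType) (n : nat) (r1 r2 : 'I_n) (T : 'M[F]_n) :
  r2 = r1.+1 :> nat -> strictly_lower T -> T r2 r1 = 0 ->
  forall i j, etoF r1 r2 T i j = T (tperm r1 r2 i) (tperm r1 r2 j).
Proof.
move=> r12 lowT T21 i j; rewrite mxE.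
have T12 : T r1 r2 = 0 by rewrite lowT // r12.
have T11 : T r1 r1 = 0 by rewrite lowT.
have T22 : T r2 r2 = 0 by rewrite lowT.
case: (tpermP r1 r2 i) => [->|->|/eqP/negPf-> /eqP/negPf->]; rewrite ?eqxx.
- by case: tpermP => [->|->|] //; rewrite T21 T22.
- have -> : r2 == r1 = false by rewrite -val_eqE /= r12 gtn_eqF.
  by case: tpermP => [->|->|] //; rewrite T12 T11.
case: tpermP => [->|->|/eqP/negPf-> /eqP/negPf-> //]; rewrite ?eqxx //.
by case: eqP => [->|].
Qed.

Lemma strictly_lower_etoF (F : fieldType) (n : nat) (r1 r2 : 'I_n)
    (T : 'M[F]_n) :
  r2 = r1.+1 :> nat -> strictly_lower T -> T r2 r1 = 0 ->
  strictly_lower (etoF r1 r2 T).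
Proof.
move=> r12 lowT T21 i j ij; rewrite etoFE //.
have [|lt] := leqP (tperm r1 r2 i) (tperm r1 r2 j); first exact: lowT.
suff [-> ->] : tperm r1 r2 i = r2 /\ tperm r1 r2 j = r1 by [].
move: lt ij.
case: (tpermP r1 r2 i) => [->|->|/eqP + /eqP];
  case: (tpermP r1 r2 j) => [->|->|/eqP + /eqP] //; rewrite -?val_eqE /=; lia.
Qed.

Lemma etoF_conj (F : fieldType) (n : nat) (r1 r2 : 'I_n) (N : 'M[F]_n) :
  r2 = r1.+1 :> nat -> strictly_lower N -> N r2 r1 = 0 ->
  tperm_mx r1 r2 *m N = etoF r1 r2 N *m tperm_mx r1 r2.
Proof.
move=> r12 lowN N21; rewrite -xrowE -xcolE; apply/matrixP => i j.
by rewrite [LHS]mxE [RHS]mxE etoFE // tpermK.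
Qed.

Lemma leqv_F (F : fieldType) (n : nat) (r1 r2 : 'I_n) (L : 'M[F]_n) :
  2%:R != 0 :> F -> r2 = r1.+1 :> nat -> strictly_lower L -> L r2 r1 = 0 ->
  leqv L (etoF r1 r2 L).
Proof.
move=> two0 r12 lowL L21.
have lowT := strictly_lower_tri lowL.
(* No index lies strictly between [r1] and [r2], so this entry is just twice [L r2 r1]. *)
have T21 : tri L r2 r1 = 0.
  move: (triK lowL) => /matrixP/(_ r2 r1); move: (tri L) lowT => T lowT.
  rewrite mulmxDr mulmx1 !mxE L21 mulr0 big1 ?addr0 // => k _.
  have [kr|rk] := leqP k r1; first by rewrite [L k r1]lowL ?mulr0.
  by rewrite lowT ?mul0r // r12.
have uU : (tperm_mx r1 r2 : 'M[F]_n) \in unitmx by exact: unitmx_perm.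
suff E : etoF r1 r2 (tri L) = tri (etoF r1 r2 L).
  rewrite /leqv -E; apply: rst_step; apply: EtoF => //.
  - by rewrite r12.
  - move=> j; rewrite leq_eqVlt => /predU1P[/val_inj <- //|].
    by rewrite -r12 => /lowT.
  move=> r /andP[r1r]; rewrite leq_eqVlt => /predU1P[/val_inj -> //|].
  by rewrite r12 ltnS => rr1; rewrite lowT.
apply: (can_inj (mulmxK uU)); rewrite -etoF_conj //.
rewrite (tri_conj uU lowL (strictly_lower_etoF r12 lowL L21)) //.
exact: etoF_conj.
Qed.

(** * Effect of the operations on the relations between two algebras *)

(* A linear map sending each [D_i] to the row [i] of [B] turns the relation
   [D_i ^+ 2 - L_i ^+ 2] into a combination of the relations given by [M];
   quadratic forms are compared through their symmetric matrices. *)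
Definition related (F : fieldType) (n : nat) (L B M : 'M[F]_n) : Prop :=
  forall i, exists c : 'I_n -> F, forall p q,
    B i p * B i q - (L *m B) i p * (L *m B) i q =
    \sum_k c k * ((k == p)%:R * (k == q)%:R - M k p * M k q).

Lemma mul_rowQ (F : fieldType) (n : nat) (r k : 'I_n) (b : F)
    (L B : 'M[F]_n) (i p : 'I_n) :
  (rowQ r k b L *m B) i p =
    (L *m B) i p - (i == r)%:R * b * (B k p + (L *m B) k p).
Proof.
rewrite mulmxBl -scalemxAl -mulmxA mulmxDl mul1mx.
rewrite [LHS]mxE [X in _ + X]mxE [X in _ - X]mxE mul_delta_mxE.
by rewrite [X in _ * (_ * X)]mxE mulrCA mulrA.
Qed.

Lemma related_rowQ (F : fieldType) (n : nat) (r k : 'I_n) (x y : F)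
    (L B M : 'M[F]_n) :
  (forall j, L r j = x * (j == k)%:R + y * L k j) ->
  related L B M -> related (rowQ r k (x + y) L) B M.
Proof.
move=> Lr rel i; have [c Ec] := rel i; have [ck Eck] := rel k.
have [ir|ir] := eqVneq i r; last first.
  by exists c => p q; rewrite -Ec !mul_rowQ (negPf ir) !mul0r !subr0.
(* [(x D + y L) ^+ 2 - (y D + x L) ^+ 2 = (x ^+ 2 - y ^+ 2) (D ^+ 2 - L ^+ 2)], so the new relation
   differs from the old one by a multiple of relation [k]. *)
exists (fun l => c l + (x ^+ 2 - y ^+ 2) * ck l) => p q.
under eq_bigr => l _ do rewrite mulrDl -mulrA.
rewrite big_split -mulr_sumr /= -Ec -Eck !mul_rowQ ir eqxx !mulr1n !mul1r.
have LB t : (L *m B) r t = x * B k t + y * (L *m B) k t.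
  rewrite !mxE; under eq_bigr => l _ do rewrite Lr mulrDl -!mulrA.
  rewrite big_split -!mulr_sumr /=; congr (x * _ + _).
  rewrite (bigD1 k) //= eqxx mul1r big1 ?addr0 // => l /negPf->.
  by rewrite mul0r.
by rewrite !LB; ring.
Qed.

Lemma related_etoP (F : fieldType) (n : nat) (r : 'I_n) (a : F)
    (L B M : 'M[F]_n) :
  a != 0 -> strictly_lower L -> related L B M ->
  related (etoP r L a) (scale_mx r a *m B) M.
Proof.
move=> a0 lowL rel i; have [c Ec] := rel i.
rewrite mulmxA -etoP_conj // -mulmxA !mul_diag_mx.
pose u : F := if i == r then a^-1 else 1.
exists (fun k => u ^+ 2 * c k) => p q.
under eq_bigr => l _ do rewrite -mulrA.
by rewrite -mulr_sumr -Ec !mxE -/u; ring.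
Qed.

Lemma related_etoF (F : fieldType) (n : nat) (r1 r2 : 'I_n)
    (L B M : 'M[F]_n) :
  r2 = r1.+1 :> nat -> strictly_lower L -> L r2 r1 = 0 -> related L B M ->
  related (etoF r1 r2 L) (tperm_mx r1 r2 *m B) M.
Proof.
move=> r12 lowL L21 rel i; have [c Ec] := rel (tperm r1 r2 i).
exists c => p q; rewrite mulmxA -etoF_conj // -mulmxA -!xrowE -Ec.
by rewrite ![xrow _ _ _ _ _]mxE.
Qed.

(** * Reduction of the linear map to the identity *)

Definition id_from (F : fieldType) (n m : nat) (B : 'M[F]_n) : Prop :=
  forall i k : 'I_n, (m <= i)%N || (m <= k)%N -> B i k = (i == k)%:R.

(* [B j - (L B) j] and [B j + (L B) j] are two factors of a quadratic relation;
   the leading variable [mu] occurs in that relation through [D_mu ^+ 2]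
   only. *)
Lemma related_leading (F : fieldType) (n : nat) (L B M : 'M[F]_n)
    (mu j q : 'I_n) :
  strictly_lower L -> strictly_lower M -> related L B M ->
  id_from mu.+1 B ->
  (j <= mu)%N -> q != mu ->
  B j mu * B j q = (L *m B) j mu * (L *m B) j q.
Proof.
move=> lowL lowM rel Bid jmu qmu; have [c Ec] := rel j.
have B0 (i k : 'I_n) : (i <= mu)%N -> (mu < k)%N -> B i k = 0.
  move=> imu muk; rewrite Bid ?muk ?orbT // -val_eqE ltn_eqF //.
  exact: leq_ltn_trans imu muk.
have LB0 (k : 'I_n) : (mu < k)%N -> (L *m B) j k = 0.
  move=> muk; rewrite mxE big1 // => l _.
  have [jl|lj] := leqP j l; first by rewrite lowL // mul0r.
  by rewrite B0 ?mulr0 // (leq_trans (ltnW lj)).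
(* Descending induction on [k]: the left side has no [D_k ^+ 2], and on the right only [c k] and the
   rows [M l] with [l > k], where [c l] is already 0, could produce one. *)
have c0 (k : 'I_n) : (mu < k)%N -> c k = 0.
  have [d] := ubnP (n - k); elim: d k => // d IHd k kd muk.
  have := Ec k k; rewrite B0 // LB0 // !mul0r subr0 (bigD1 k) //=.
  rewrite big1 => [|l lk].
    by rewrite eqxx lowM // !mulr0 subr0 !mulr1 addr0.
  rewrite (negPf lk) mul0r sub0r; have [lek|kl] := leqP l k.
    by rewrite lowM // mul0r oppr0 mulr0.
  rewrite IHd ?mul0r ?(ltn_trans muk) //.
  by apply: leq_trans (kd : (n - k <= d)%N); rewrite ltn_sub2l.
apply/eqP; rewrite -subr_eq0 Ec; apply/eqP/big1 => k _.
have [muk|kmu] := ltnP mu k; first by rewrite c0 // mul0r.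
rewrite [M k mu]lowM // mul0r subr0; case: eqP => [->|_]; last first.
  by rewrite mul0r mulr0.
by rewrite eq_sym (negPf qmu) !mulr0.
Qed.

Definition reducible_to_1 (F : fieldType) (n : nat) (L M : 'M[F]_n) : Prop :=
  exists L', [/\ leqv L L', strictly_lower L' & related L' 1%:M M].

(** Take [i] least with [B i mu != 0]. Then [D_mu] is absent from the image of [L_i], and
    [related_leading] forces row [i] of [B] to be a multiple of [D_mu]. *)
Lemma leading_row (F : fieldType) (n : nat) (L B M : 'M[F]_n) (mu : 'I_n) :
  strictly_lower L -> strictly_lower M -> B \in unitmx -> related L B M ->
  id_from mu.+1 B ->
  exists i : 'I_n, [/\ (i <= mu)%N, B i mu != 0,
    forall j, j != i -> B j mu = 0 & forall q, q != mu -> B i q = 0].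
Proof.
move=> lowL lowM uB rel Bid.
have [i0 i0P] : exists i, B i mu != 0.
  apply/existsP; apply/contraT; rewrite negb_exists => /forallP B0.
  have : B *m delta_mx mu (0 : 'I_1) = 0.
    apply/matrixP => i k; rewrite mxE mxE big1 // => l _; rewrite mxE.
    by case: eqP => [->|_]; rewrite ?mulr0 // (eqP (negbNE (B0 i))) mul0r.
  rewrite -(mulmx0 _ B) => /(can_inj (mulKmx uB))/matrixP/(_ mu 0).
  by rewrite !mxE !eqxx => /eqP; rewrite oner_eq0.
have [i Bi imin] := @arg_minnP _ i0 (fun i => B i mu != 0) val i0P.
have imu : (i <= mu)%N.
  rewrite leqNgt; apply: contra Bi => mui.
  by rewrite Bid ?mui // -val_eqE gtn_eqF.
have Bq q : q != mu -> B i q = 0.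
  move=> qmu; have := related_leading lowL lowM rel Bid imu qmu.
  have -> : (L *m B) i mu = 0.
    rewrite mxE big1 // => k _; have [ik|ki] := leqP i k.
      by rewrite lowL // mul0r.
    have [->|Bk] := eqVneq (B k mu) 0; first by rewrite mulr0.
    by have := imin k Bk; rewrite leqNgt ki.
  by move/eqP; rewrite mul0r mulf_eq0 (negPf Bi) => /eqP.
exists i; split=> // j ji; have [mj|jm] := ltnP mu j.
  by rewrite Bid ?mj // -val_eqE gtn_eqF.
have [ij|ij] := leqP i j; last first.
  by apply/eqP; apply: contraTT ij => /imin; rewrite -leqNgt.
(* By [related_leading] this combination of the images of [D_j] and [L_j] involves only [D_mu], and
   [c] times row [i] cancels it. Injectivity gives [v = 0], whose coordinate [j] is [B j mu] since
   [L j j = 0]. *)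
pose c := (B j mu * B j mu - (L *m B) j mu * (L *m B) j mu) / B i mu.
pose v := B j mu *: delta_mx 0 j - (L *m B) j mu *: row j L - c *: delta_mx 0 i.
have vB q : (v *m B) 0 q =
    B j mu * B j q - (L *m B) j mu * (L *m B) j q - c * B i q.
  rewrite /v !mulmxBl -!scalemxAl -!rowE -row_mul; move: (L *m B) => LB.
  by rewrite !mxE.
have : v *m B = 0 *m B.
  rewrite mul0mx; apply/rowP => q; rewrite vB [RHS]mxE.
  have [->|qmu] := eqVneq q mu; first by rewrite mulfVK // subrr.
  by rewrite Bq // mulr0 subr0 (related_leading lowL lowM rel Bid) // subrr.
move/(can_inj (mulmxK uB))/rowP/(_ j).
rewrite !mxE !eqxx (negPf ji) mulr1 mulr0 subr0 lowL // mulr0 subr0 //.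
Qed.

(** The outer induction fixes the variables one by one from the last. The inner one moves the row
    [i] of [leading_row] to position [mu] by adjacent exchanges (F); there (P) normalises its
    coefficient to 1. *)
Lemma reduce_to_1 (F : fieldType) (n m : nat) (L B M : 'M[F]_n) :
  2%:R != 0 :> F -> strictly_lower M ->
  strictly_lower L -> B \in unitmx -> related L B M -> id_from m B ->
  reducible_to_1 L M.
Proof.
move=> two0 lowM; elim: m L B => [|m IHm] L B lowL uB rel Bid.
  have B1 : B = 1%:M by apply/matrixP => i j; rewrite Bid // mxE.
  by exists L; split=> //; [exact: leqv_refl | rewrite -B1].
have [nm|mn] := leqP n m.
  apply: (IHm L B) => // i k.
  by rewrite (leqNgt m i) (leqNgt m k) !(leq_trans (ltn_ord _) nm).
pose mu := Ordinal mn.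
have [i [imu Bi Bj Bq]] := @leading_row _ _ L B M mu lowL lowM uB rel Bid.
have [d] : exists d, (i + d = m)%N by exists (m - i)%N; rewrite subnKC.
elim: d i {imu} L B lowL uB rel Bid Bi Bj Bq =>
  [|d IHd] i L B lowL uB rel Bid Bi Bj Bq idm.
  have {}idm : i = mu by apply: val_inj; rewrite /= -idm addn0.
  subst i.
  have [|||i k|L' [e lowL' rel']] :=
    IHm (etoP mu L (B mu mu)) (scale_mx mu (B mu mu) *m B).
  - exact: strictly_lower_etoP.
  - by rewrite unitmx_mul scale_mx_unit.
  - exact: related_etoP.
  - rewrite mul_diag_mx !mxE !(leq_eqVlt m) => mik.
    have [->|imu] := eqVneq i mu.
      have [->|kmu] := eqVneq k mu; first by rewrite mulVf.
      by rewrite (Bq _ kmu) mulr0.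
    rewrite mul1r; have [->|kmu] := eqVneq k mu.
      by rewrite (Bj _ imu) (negPf imu).
    apply: Bid; move: mik; rewrite -![m == _]/(val mu == val _) !val_eqE.
    by rewrite !(eq_sym mu) (negPf imu) (negPf kmu).
  by exists L'; split=> //; apply: leqv_trans e; exact: leqv_P.
have im : (i < m)%N by rewrite -idm addnS ltnS leq_addr.
pose j : 'I_n := Ordinal (leq_ltn_trans im mn).
have ij : (i < j)%N by [].
have ji : j != i by rewrite -val_eqE gtn_eqF.
(* As [B j mu = 0], [related_leading] makes the image of [L_j] a multiple of [D_mu], that is, of the
   image of [D_i]. *)
have Lj : L j i != 0 -> forall q, L j q = L j i * (q == i)%:R + 0 * L i q.
  move=> Lji.
  have LB : (L *m B) j mu = L j i * B i mu.
    by rewrite mxE (bigD1 i) //= big1 ?addr0 // => k /Bj->; rewrite mulr0.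
  have : row j L *m B = (L j i *: delta_mx 0 i) *m B.
    rewrite -row_mul -scalemxAl -rowE; apply/rowP => q.
    rewrite [LHS]mxE [RHS]mxE [in RHS]mxE.
    have [->|qmu] := eqVneq q mu; first exact: LB.
    rewrite Bq // mulr0.
    have := @related_leading _ _ L B M mu j q lowL lowM rel Bid im qmu.
    rewrite Bj // mul0r LB => /esym/eqP.
    by rewrite !mulf_eq0 (negPf Lji) (negPf Bi) => /eqP.
  move/(can_inj (mulmxK uB))/rowP/(_ _) => E q; have := E q.
  by rewrite !mxE mul0r addr0.
have [L1 [e1 lowL1 rel1 L1ji]] :
    exists L1, [/\ leqv L L1, strictly_lower L1, related L1 B M & L1 j i = 0].
  have [L0|Lji] := eqVneq (L j i) 0.
    by exists L; split=> //; exact: leqv_refl.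
  (* (Q) turns [L j i * D_i] into [- L j i * L_i], which is free of [D_i], so that (F) may exchange
     [i] and [j]. *)
  exists (rowQ j i (L j i + 0) L); split.
  - exact: leqv_Q (Lj Lji).
  - exact: strictly_lower_rowQ.
  - exact: related_rowQ (Lj Lji) rel.
  - by rewrite rowQE !eqxx (lowL i i) // !addr0 mulr1 subrr.
have ji1 : j = i.+1 :> nat by [].
have TB k q : (tperm_mx i j *m B) k q = B (tperm i j k) q by rewrite -xrowE mxE.
have mutp (k : 'I_n) : (m < k)%N -> tperm i j k = k.
  move=> mk; rewrite tpermD // -val_eqE neq_ltn /=.
    by rewrite (ltn_trans im).
  by rewrite (leq_ltn_trans im).
have [|||k q|||q||L' [e lowL' rel']] := IHd j (etoF i j L1) (tperm_mx i j *m B).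
- exact: strictly_lower_etoF.
- by rewrite unitmx_mul unitmx_perm.
- exact: related_etoF.
- rewrite TB => /orP[mk|mq]; first by rewrite mutp // Bid ?mk.
  by rewrite Bid ?mq ?orbT // -{1}(mutp q mq) (inj_eq perm_inj).
- by rewrite TB tpermR.
- move=> k kj; rewrite TB Bj //.
  by rewrite -(inj_eq (@perm_inj _ (tperm i j))) tpermK tpermL.
- by rewrite TB tpermR; apply: Bq.
- by rewrite -idm addnS.
exists L'; split=> //; apply: leqv_trans e1 _; apply: leqv_trans e.
exact: leqv_F.
Qed.

(** * Classification in size 4 by the invariants of the rows *)

Lemma leqv_row (F : fieldType) (n : nat) (r k : 'I_n) (x y : F)
    (L L' : 'M[F]_n) :
  2%:R != 0 :> F -> (k < r)%N -> strictly_lower L ->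
  (forall j, L r j = x * (j == k :> nat)%:R + y * L k j) ->
  (forall j, L' r j = - (y * (j == k :> nat)%:R + x * L k j)) ->
  (forall i j, i != r -> L' i j = L i j) ->
  leqv L L'.
Proof.
move=> two0 kr lowL Lr L'r L'i.
suff -> : L' = rowQ r k (x + y) L by exact: leqv_Q.
apply/matrixP => i j; rewrite rowQE; case: eqVneq => [->|]; last exact: L'i.
by rewrite L'r Lr -val_eqE /=; ring.
Qed.

(** The default value of [nth] supplies the zeros on and above the diagonal. *)
Definition lam (F : fieldType) (s b c x y z : F) : 'M[F]_4 :=
  \matrix_(i, j)
    nth 0 (nth [::] [:: [::]; [:: s]; [:: b; c]; [:: x; y; z]] i) j.

Lemma strictly_lower_lam (F : fieldType) (s b c x y z : F) :
  strictly_lower (lam s b c x y z).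
Proof.
by case=> [[|[|[|[|//]]]] ?]; case=> [[|[|[|[|//]]]] ?]; rewrite !mxE.
Qed.

Lemma lam_exists (F : fieldType) (L : 'M[F]_4) :
  strictly_lower L -> exists s b c x y z, L = lam s b c x y z.
Proof.
move=> lowL; pose o k : 'I_4 := inord k.
exists (L (o 1%N) (o 0%N)), (L (o 2%N) (o 0%N)), (L (o 2%N) (o 1%N)),
  (L (o 3%N) (o 0%N)), (L (o 3%N) (o 1%N)), (L (o 3%N) (o 2%N)).
apply/matrixP; case=> [[|[|[|[|//]]]] ?]; case=> [[|[|[|[|//]]]] ?];
  rewrite mxE /=; (by rewrite lowL) ||
    by congr (L _ _); apply/val_inj; rewrite /= inordK.
Qed.

(** Since [L_0 = 0], the coefficient [y] of [leqv_row] is free; [y = - s'] makes the new row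
    [s' D_0]. *)
Lemma lam_row1 (F : fieldType) (s s' b c x y z : F) :
  2%:R != 0 :> F -> leqv (lam s b c x y z) (lam s' b c x y z).
Proof.
move=> two0.
apply: (@leqv_row F 4 (@Ordinal 4 1 isT) (@Ordinal 4 0 isT) s (- s')) => //.
- exact: strictly_lower_lam.
- by case=> [[|[|[|[|//]]]] ?]; rewrite !mxE /=; ring.
- by case=> [[|[|[|[|//]]]] ?]; rewrite !mxE /=; ring.
by case=> [[|[|[|[|//]]]] ?] j //; rewrite !mxE.
Qed.

Lemma lam_row2_0 (F : fieldType) (s b b' x y z : F) :
  2%:R != 0 :> F -> leqv (lam s b 0 x y z) (lam s b' 0 x y z).
Proof.
move=> two0.
apply: (@leqv_row F 4 (@Ordinal 4 2 isT) (@Ordinal 4 0 isT) b (- b')) => //.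
- exact: strictly_lower_lam.
- by case=> [[|[|[|[|//]]]] ?]; rewrite !mxE /=; ring.
- by case=> [[|[|[|[|//]]]] ?]; rewrite !mxE /=; ring.
by case=> [[|[|[|[|//]]]] ?] j //; rewrite !mxE.
Qed.

Lemma lam_row2_1 (F : fieldType) (s w c x y z : F) :
  2%:R != 0 :> F ->
  leqv (lam s (w * s) c x y z) (lam s (- (c * s)) (- w) x y z).
Proof.
move=> two0.
apply: (@leqv_row F 4 (@Ordinal 4 2 isT) (@Ordinal 4 1 isT) c w) => //.
- exact: strictly_lower_lam.
- by case=> [[|[|[|[|//]]]] ?]; rewrite !mxE /=; ring.
- by case=> [[|[|[|[|//]]]] ?]; rewrite !mxE /=; ring.
by case=> [[|[|[|[|//]]]] ?] j //; rewrite !mxE.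
Qed.

Lemma lam_row3_0 (F : fieldType) (s b c x x' : F) :
  2%:R != 0 :> F -> leqv (lam s b c x 0 0) (lam s b c x' 0 0).
Proof.
move=> two0.
apply: (@leqv_row F 4 (@Ordinal 4 3 isT) (@Ordinal 4 0 isT) x (- x')) => //.
- exact: strictly_lower_lam.
- by case=> [[|[|[|[|//]]]] ?]; rewrite !mxE /=; ring.
- by case=> [[|[|[|[|//]]]] ?]; rewrite !mxE /=; ring.
by case=> [[|[|[|[|//]]]] ?] j //; rewrite !mxE.
Qed.

Lemma lam_row3_1 (F : fieldType) (s b c w y : F) :
  2%:R != 0 :> F ->
  leqv (lam s b c (w * s) y 0) (lam s b c (- (y * s)) (- w) 0).
Proof.
move=> two0.
apply: (@leqv_row F 4 (@Ordinal 4 3 isT) (@Ordinal 4 1 isT) y w) => //.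
- exact: strictly_lower_lam.
- by case=> [[|[|[|[|//]]]] ?]; rewrite !mxE /=; ring.
- by case=> [[|[|[|[|//]]]] ?]; rewrite !mxE /=; ring.
by case=> [[|[|[|[|//]]]] ?] j //; rewrite !mxE.
Qed.

Lemma lam_row3_2 (F : fieldType) (s b c w z : F) :
  2%:R != 0 :> F ->
  leqv (lam s b c (w * b) (w * c) z) (lam s b c (- (z * b)) (- (z * c)) (- w)).
Proof.
move=> two0.
apply: (@leqv_row F 4 (@Ordinal 4 3 isT) (@Ordinal 4 2 isT) z w) => //.
- exact: strictly_lower_lam.
- by case=> [[|[|[|[|//]]]] ?]; rewrite !mxE /=; ring.
- by case=> [[|[|[|[|//]]]] ?]; rewrite !mxE /=; ring.
by case=> [[|[|[|[|//]]]] ?] j //; rewrite !mxE.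
Qed.

Lemma lam_opp3 (F : fieldType) (s b c x y z : F) :
  leqv (lam s b c x y z) (lam s b c (- x) (- y) (- z)).
Proof.
have -> : lam s b c (- x) (- y) (- z) =
    etoP (@Ordinal 4 3 isT) (lam s b c x y z) (-1).
  apply/matrixP; case=> [[|[|[|[|//]]]] ?]; case=> [[|[|[|[|//]]]] ?];
  by rewrite !mxE /= ?invrN1 ?mulN1r ?oppr0.
by apply: leqv_P; [rewrite oppr_eq0 oner_eq0 | exact: strictly_lower_lam].
Qed.

(* [f s b c] has a row [s D_0] and a later row [b D_0 + c D_1]; since [D_0] and
   [D_1] square to 0, only the product [b c] matters. *)
Lemma leqv_product (F : fieldType) (f : F -> F -> F -> 'M[F]_4) :
  (forall s s' b c, leqv (f s b c) (f s' b c)) ->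
  (forall s b b', leqv (f s b 0) (f s b' 0)) ->
  (forall s w c, leqv (f s (w * s) c) (f s (- (c * s)) (- w))) ->
  forall s b c b' c', b * c = b' * c' -> leqv (f s b c) (f s b' c').
Proof.
move=> f1 f0 fQ s b c b' c' bc.
have [bc0|bc0] := eqVneq (b * c) 0.
  have f00 b1 c1 : b1 * c1 = 0 -> leqv (f s b1 c1) (f s 0 0).
    move/eqP; rewrite mulf_eq0 => /orP[/eqP->|/eqP->]; last exact: f0.
    (* For [b1 = 0], (Q) sends the row [c1 D_1] to [- c1 L_1], which is 0 while [s] is set to 0. *)
    apply: leqv_trans (f1 s 0 _ _) _; apply: leqv_trans (f1 0 s _ _).
    by have := fQ 0 0 c1; rewrite mul0r mulr0 oppr0.
  by apply: leqv_trans (f00 _ _ bc0) _; apply/leqv_sym/f00; rewrite -bc.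
have [b0 c0] : b != 0 /\ c != 0.
  by apply/andP; rewrite -negb_or -mulf_eq0.
have [b'0 c'0] : b' != 0 /\ c' != 0.
  by apply/andP; rewrite -negb_or -mulf_eq0 -bc.
(* With [s = 1], (Q) exchanges the two entries up to sign; with [s = b' / b], a second (Q) exchanges
   them back, rescaled to [b'] and [c']. *)
apply: leqv_trans (f1 s 1 _ _) _; have := fQ 1 b c; rewrite !mulr1 => e1.
apply: leqv_trans e1 _; apply: leqv_trans (f1 1 (b' / b) _ _) _.
apply: leqv_trans (f1 (b' / b) s _ _).
have := fQ (b' / b) (- (c * b / b')) (- b).
have -> : - (- b * (b' / b)) = b' by rewrite mulNr opprK mulrC divfK.
have -> : - - (c * b / b') = c' by rewrite opprK (mulrC c) bc mulrC mulKf.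
by have -> : - (c * b / b') * (b' / b) = - c by field; rewrite b0 b'0.
Qed.

Lemma lam_row2 (F : fieldType) (s b c b' c' x y z : F) :
  2%:R != 0 :> F -> b * c = b' * c' ->
  leqv (lam s b c x y z) (lam s b' c' x y z).
Proof.
move=> two0; apply: (leqv_product (f := fun s b c => lam s b c x y z)) => *.
- exact: lam_row1.
- exact: lam_row2_0.
exact: lam_row2_1.
Qed.

Lemma lam_row3_z0 (F : fieldType) (s b c x y x' y' : F) :
  2%:R != 0 :> F -> x * y = x' * y' ->
  leqv (lam s b c x y 0) (lam s b c x' y' 0).
Proof.
move=> two0; apply: (leqv_product (f := fun s x y => lam s b c x y 0)) => *.
- exact: lam_row1.
- exact: lam_row3_0.
exact: lam_row3_1.
Qed.

(** Row 2 is replaced for a while by [(b', c')], which makes the last row [z D_2 + w L_2]; (Q)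
    exchanges [z] and [w], (P) corrects the sign, and row 2 is restored. *)
Lemma lam_row3_swap (F : fieldType) (s b c b' c' w z : F) :
  2%:R != 0 :> F -> b * c = b' * c' ->
  leqv (lam s b c (w * b') (w * c') z) (lam s b c (z * b') (z * c') w).
Proof.
move=> two0 bc; apply: leqv_trans (lam_row2 _ _ _ _ two0 bc) _.
apply: leqv_trans (lam_row3_2 _ _ _ _ _ two0) _.
apply: leqv_trans (lam_opp3 _ _ _ _ _ _) _; rewrite !opprK.
exact/leqv_sym/lam_row2.
Qed.

Lemma lam_row3 (F : fieldType) (s b c x y z x' y' z' : F) :
  2%:R != 0 :> F ->
  x * y + b * c * z ^+ 2 = x' * y' + b * c * z' ^+ 2 ->
  x * z = x' * z' -> y * z = y' * z' ->
  leqv (lam s b c x y z) (lam s b c x' y' z').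
Proof.
move=> two0.
wlog z0 : x y z x' y' z' / z != 0.
  move=> IH exy exz eyz; have [z0|] := eqVneq z 0; last by move=> z0; exact: IH.
  have [z'0|z'0] := eqVneq z' 0; last by apply: leqv_sym; exact: IH.
  rewrite z0 z'0 in exy *; apply: lam_row3_z0 => //.
  by move: exy; rewrite expr0n !mulr0 !addr0.
move=> exy exz eyz.
have [z'0|z'0] := eqVneq z' 0.
  move: exz eyz exy; rewrite z'0 !mulr0 expr0n mulr0 addr0.
  move=> /eqP; rewrite mulf_eq0 (negPf z0) orbF => /eqP->.
  move=> /eqP; rewrite mulf_eq0 (negPf z0) orbF => /eqP-> exy.
  rewrite mul0r add0r in exy.
  (* The source row is [z D_2]: this is [lam_row3_swap] with [w = 0], for the factorisation of
     [b * c] read off from the target row. *)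
  have bc : b * c = (x' / z) * (y' / z).
    by apply: (mulIf (expf_neq0 2 z0)); rewrite exy; field.
  have := lam_row3_swap s 0 z two0 bc.
  by rewrite !mul0r ![z * _]mulrC !divfK.
have ex' : x' = z * (x / z') by rewrite mulrA (mulrC z) exz mulfK.
have ey' : y' = z * (y / z') by rewrite mulrA (mulrC z) eyz mulfK.
(* Eliminating [x'] and [y'] leaves three factors: the rows are equal, opposite, or exchanged by
   [lam_row3_swap]. *)
have : (z' - z) * (z' + z) * (x * y - b * c * z' ^+ 2) = 0.
  rewrite [LHS](_ : _ = z' ^+ 2 * (x * y + b * c * z ^+ 2) -
    (x * z) * (y * z) - b * c * z' ^+ 2 * z' ^+ 2); last by ring.
  by rewrite exy exz eyz; ring.
move/eqP; rewrite !mulf_eq0 -orbA subr_eq0 addr_eq0 subr_eq0.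
move=> /or3P[/eqP e|/eqP e|/eqP e].
- move: exz eyz; rewrite e => /(mulIf z0)-> /(mulIf z0)->.
  exact: leqv_refl.
- move: exz eyz; rewrite e !mulrN -!mulNr => /(mulIf z0)-> /(mulIf z0)->.
  apply: leqv_sym; rewrite -[X in leqv _ (lam _ _ _ _ _ X)]opprK.
  exact: lam_opp3.
have bc : b * c = (x / z') * (y / z').
  by apply: (mulIf (expf_neq0 2 z'0)); rewrite -e; field.
have := lam_row3_swap s z' z two0 bc.
by rewrite -ex' -ey' ![z' * _]mulrC !divfK.
Qed.

Lemma related_1_leqv (F : fieldType) (L M : 'M[F]_4) :
  2%:R != 0 :> F -> strictly_lower L -> strictly_lower M ->
  related L 1%:M M -> leqv L M.
Proof.
move=> two0 /lam_exists[s [b [c [x [y [z ->]]]]]].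
move=> /lam_exists[s' [b' [c' [x' [y' [z' ->]]]]]] rel.
pose o0 := @Ordinal 4 0 isT; pose o1 := @Ordinal 4 1 isT.
pose o2 := @Ordinal 4 2 isT; pose o3 := @Ordinal 4 3 isT.
have [e Ee] := rel o2; have [g Eg] := rel o3.
(* This is the unsimplified shape in which the products occur in the off-diagonal entries, so that
   those entries can be rewritten. *)
have neg u v : u * v = - (0 * 0 - u * v) :> F by ring.
(* The diagonal entries determine the coefficients of the relations; the mixed entries then give the
   invariants. *)
have eqs2 : b * c = b' * c'.
  move: (Ee o3 o3) (Ee o2 o2) (Ee o0 o1); rewrite mulmx1.
  rewrite !big_ord_recl !big_ord0 !mxE /=.
  move: (e _) (e _) (e _) (e _) => e3 e2 e1 e0 h33 h22 h01.
  have E3 : e3 = 0 * 0 - 0 * 0 by rewrite h33; ring.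
  have E2 : e2 = 1 * 1 - 0 * 0 by move: h22; rewrite E3 => ->; ring.
  by rewrite (neg b c) h01 E2 E3; ring.
have eqs3 : [/\ x * y + b' * c' * z ^+ 2 = x' * y' + b' * c' * z' ^+ 2,
   x * z = x' * z' & y * z = y' * z'].
  move: (Eg o3 o3) (Eg o2 o2) (Eg o0 o1) (Eg o0 o2) (Eg o1 o2); rewrite mulmx1.
  rewrite !big_ord_recl !big_ord0 !mxE /=.
  move: (g _) (g _) (g _) (g _) => g3 g2 g1 g0 h33 h22 h01 h02 h12.
  have G3 : g3 = 1 by transitivity (1 * 1 - 0 * 0 : F); [rewrite h33|]; ring.
  have G2 : g2 = (0 * 0 - z * z) + z' * z' by rewrite h22 G3; ring.
  split; first by rewrite (neg x y) h01 G2 G3; ring.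
    by rewrite (neg x z) h02 G3; ring.
  by rewrite (neg y z) h12 G3; ring.
have [exy exz eyz] := eqs3.
apply: leqv_trans (lam_row1 _ s' _ _ _ _ _ two0) _.
apply: leqv_trans (lam_row2 _ _ _ _ two0 eqs2) _.
exact: lam_row3.
Qed.

(** * From a graded isomorphism to relations between quadratic forms *)

Lemma alg_pi0 (F : fieldType) (n : nat) (T : 'M[F]_n) : alg_pi T 0 = 0.
Proof. exact: (raddf0 (\pi_({ideal_quot (relations T)})%qT)). Qed.

Lemma alg_piN (F : fieldType) (n : nat) (T : 'M[F]_n) (p : {mpoly F[n]}) :
  alg_pi T (- p) = - alg_pi T p.
Proof. exact: (raddfN (\pi_({ideal_quot (relations T)})%qT)). Qed.

Lemma alg_piZ (F : fieldType) (n : nat) (T : 'M[F]_n) (c : F)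
    (p : {mpoly F[n]}) :
  alg_pi T (c *: p) = c *: alg_pi T p.
Proof. by rewrite -mul_mpolyC alg_piM. Qed.

Lemma alg_pi_eq0 (F : fieldType) (n : nat) (T : 'M[F]_n) (p : {mpoly F[n]}) :
  alg_pi T p = 0 <-> p \in relations T.
Proof.
rewrite -(alg_pi0 T) -[p in p \in _]subr0.
rewrite (ring_quotient.Quotient.idealrBE (relations T)).
by split=> /eqP.
Qed.

Definition lin (F : fieldType) (n : nat) (v : 'rV[F]_n) : {mpoly F[n]} :=
  \sum_j v 0 j *: 'X_j.

Lemma linB (F : fieldType) (n : nat) (u v : 'rV[F]_n) :
  lin (u - v) = lin u - lin v.
Proof. by rewrite -sumrB; apply: eq_bigr => j _; rewrite !mxE scalerBl. Qed.

Lemma linZ (F : fieldType) (n : nat) (c : F) (v : 'rV[F]_n) :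
  lin (c *: v) = c *: lin v.
Proof. by rewrite scaler_sumr; apply: eq_bigr => j _; rewrite mxE scalerA. Qed.

Lemma lin_delta (F : fieldType) (n : nat) (i : 'I_n) :
  lin (delta_mx 0 i) = 'X_i :> {mpoly F[n]}.
Proof.
rewrite /lin (bigD1 i) //= mxE !eqxx scale1r big1 ?addr0 // => j ji.
by rewrite mxE (negPf ji) andbF scale0r.
Qed.

Lemma lin_at0 (F : fieldType) (n : nat) (v : 'rV[F]_n) :
  meval (fun=> 0) (lin v) = 0.
Proof.
rewrite [meval _ _]raddf_sum big1 // => j _.
by rewrite /= mevalZ mevalXU mulr0.
Qed.

Lemma mderiv_lin (F : fieldType) (n : nat) (v : 'rV[F]_n) (j : 'I_n) :
  mderiv j (lin v) = (v 0 j)%:MP.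
Proof.
rewrite [mderiv _ _]raddf_sum (bigD1 j) //= big1 => [|k kj]; last first.
  by rewrite mderivZ mderivX mnm1E (negPf kj) scale0r scaler0.
rewrite addr0 mderivZ mderivX mnm1E eqxx scale1r.
have -> : (U_(j) - U_(j))%MM = 0%MM :> 'X_{1..n}.
  by apply/mnmP => l; rewrite mnmBE subnn mnm0E.
by rewrite mpolyX0 -mul_mpolyC mulr1.
Qed.

(** Derivatives at the origin see only the linear part, and second derivatives only the quadratic
    part. *)
Definition gradient (F : fieldType) (n : nat) (j : 'I_n) (p : {mpoly F[n]}) :=
  meval (fun=> 0) (mderiv j p).

Definition hessian (F : fieldType) (n : nat) (j k : 'I_n) (p : {mpoly F[n]}) :=
  meval (fun=> 0) (mderiv k (mderiv j p)).

Lemma gradientM (F : fieldType) (n : nat) (j : 'I_n) (h p : {mpoly F[n]}) :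
  meval (fun=> 0) p = 0 -> gradient j p = 0 -> gradient j (h * p) = 0.
Proof.
rewrite /gradient => p0 dp0.
by rewrite mderivM mevalD !mevalM p0 dp0 !mulr0 addr0.
Qed.

Lemma hessianM (F : fieldType) (n : nat) (j k : 'I_n) (h p : {mpoly F[n]}) :
  meval (fun=> 0) p = 0 -> (forall l, gradient l p = 0) ->
  hessian j k (h * p) = meval (fun=> 0) h * hessian j k p.
Proof.
move=> p0 dp0; rewrite /hessian mderivM mderivD !mderivM !mevalD !mevalM p0.
have dp l : meval (fun=> 0) (mderiv l p) = 0 by exact: dp0.
by rewrite !dp !mulr0 !add0r.
Qed.

Lemma gradient_lin (F : fieldType) (n : nat) (j : 'I_n) (v : 'rV[F]_n) :
  gradient j (lin v) = v 0 j.
Proof. by rewrite /gradient mderiv_lin mevalC. Qed.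

Lemma hessian_lin (F : fieldType) (n : nat) (j k : 'I_n) (u v : 'rV[F]_n) :
  hessian j k (lin u * lin v) = u 0 j * v 0 k + u 0 k * v 0 j.
Proof.
rewrite /hessian mderivM !mderiv_lin mderivD !mderivM !mderiv_lin !mderivC.
by rewrite mul0r mulr0 add0r addr0 mevalD !mevalM !mevalC.
Qed.

Lemma relator_lin (F : fieldType) (n : nat) (T : 'M[F]_n) (i : 'I_n) :
  strictly_lower T ->
  relator T i = lin (delta_mx 0 i) * lin (delta_mx 0 i - row i T).
Proof.
move=> lowT; rewrite linB lin_delta mulrBr -expr2 /relator; congr (_ - _).
rewrite mulr_sumr [RHS](bigID (fun j : 'I_n => (j < i)%N)) /=.
rewrite [X in _ + X]big1 ?addr0 => [|j]; last first.
  by rewrite -leqNgt => ij; rewrite mxE lowT // scale0r mulr0.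
by apply: eq_bigr => j _; rewrite mxE -scalerAr mulrC.
Qed.

(** Completing the square: [4 (X ^+ 2 - L X) = (2 X - L) ^+ 2 - L ^+ 2]. *)
Lemma relator_squares (F : fieldType) (n : nat) (T : 'M[F]_n) (i : 'I_n) :
  strictly_lower T ->
  4%:R *: relator T i = lin (row i (2%:R%:M - T)) * lin (row i (2%:R%:M - T))
                        - lin (row i T) * lin (row i T).
Proof.
move=> lowT; rewrite relator_lin //.
have -> : row i (2%:R%:M - T) = 2%:R *: delta_mx 0 i - row i T.
  by apply/rowP => j; rewrite !mxE eqxx eq_sym mulr_natr.
rewrite !linB linZ -!mul_mpolyC !rmorph_nat; ring.
Qed.

Lemma relator_gradient (F : fieldType) (n : nat) (T : 'M[F]_n) (i j : 'I_n) :
  strictly_lower T -> gradient j (relator T i) = 0.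
Proof.
move=> lowT; rewrite relator_lin // /gradient mderivM mevalD !mevalM !lin_at0.
by rewrite mulr0 mul0r addr0.
Qed.

(** Relators have neither constant nor linear part. Hence a linear form in the ideal is 0, which
    makes the degree 2 part of an isomorphism injective. *)
Lemma relations_gradient (F : fieldType) (n : nat) (T : 'M[F]_n) (j : 'I_n)
    (p : {mpoly F[n]}) :
  strictly_lower T -> p \in relations T -> gradient j p = 0.
Proof.
move=> lowT /relationsP[h ->].
rewrite /gradient (big_morph _ (mderivD j) (mderiv0 _ j)).
rewrite (big_morph _ (mevalD _) (meval0 _)) big1 // => i _.
apply: gradientM; first exact: relator_at0.
exact: relator_gradient.
Qed.

(** Relators vanish to order 2 at the origin, so only the constant terms of their multipliers
    contribute. *)
Lemma relations_hessian (F : fieldType) (n : nat) (T : 'M[F]_n)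
    (p : {mpoly F[n]}) :
  strictly_lower T -> p \in relations T ->
  exists c : 'I_n -> F, forall j k,
    hessian j k p = \sum_i c i * hessian j k (relator T i).
Proof.
move=> lowT /relationsP[h ->]; exists (fun i => meval (fun=> 0) (h i)) => j k.
rewrite /hessian (big_morph _ (mderivD j) (mderiv0 _ j)).
rewrite (big_morph _ (mderivD k) (mderiv0 _ k)).
rewrite (big_morph _ (mevalD _) (meval0 _)); apply: eq_bigr => i _.
apply: hessianM; first exact: relator_at0.
by move=> l; exact: relator_gradient.
Qed.

Lemma lin_homog (F : fieldType) (n : nat) (p : {mpoly F[n]}) :
  {in msupp p, forall m : 'X_{1..n}, (2 * mdeg m)%N = 2%N} ->
  exists v, p = lin v.
Proof.
move=> hp; exists (\row_j p@_U_(j)); apply/mpolyP => m.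
rewrite raddf_sum /=; under eq_bigr => j _ do rewrite mxE mcoeffZ mcoeffX.
have [/eqP/mdeg1P[i /eqP->]|m1] := eqVneq (mdeg m) 1%N.
  rewrite (bigD1 i) //= eqxx mulr1 big1 ?addr0 // => j ji.
  by rewrite eq_mnm1 (negPf ji) mulr0.
rewrite big1 => [|j _]; last first.
  by case: (eqVneq U_(j)%MM m) m1 => [<-|_ _]; rewrite ?mdeg1 ?mulr0.
apply/eqP; rewrite mcoeff_eq0; apply: contra m1 => /hp/eqP.
by rewrite -[X in _ == X]muln1 eqn_pmul2l.
Qed.

(** [G] is the matrix of the isomorphism in degree 2. It sends relators of [T] into the ideal of
    [S], and second derivatives at the origin compare the quadratic parts. *)
Lemma graded_iso_related (F : fieldType) (n : nat) (T S : 'M[F]_n) :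
  2%:R != 0 :> F -> strictly_lower T -> strictly_lower S -> graded_iso T S ->
  exists G : 'M[F]_n, G \in unitmx /\
    forall i, exists c : 'I_n -> F, forall p q,
      let d := row i (2%:R%:M - T) *m G in let t := row i T *m G in
      d 0 p * d 0 q - t 0 p * t 0 q =
      \sum_k c k * ((2%:R%:M - S) k p * (2%:R%:M - S) k q - S k p * S k q).
Proof.
move=> two0 lowT lowS [f [bijf grf]].
have [G fX] : exists G : 'M[F]_n,
    forall i, f (alg_pi T 'X_i) = alg_pi S (lin (row i G)).
  have fX i : exists v : 'rV_n, f (alg_pi T 'X_i) = alg_pi S (lin v).
    have [p /lin_homog[v ->] ->] : graded_part 2 (f (alg_pi T 'X_i)).
      apply: grf; exists 'X_i => // m; rewrite msuppX inE => /eqP->.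
      by rewrite mdeg1.
    by exists v.
  have [v vP] := choice fX; exists (\matrix_i v i) => i.
  by rewrite vP rowK.
have fL v : f (alg_pi T (lin v)) = alg_pi S (lin (v *m G)).
  have piD U : {morph @alg_pi F n U : x y / x + y} := @alg_piD F n U.
  rewrite /lin (big_morph _ (piD T) (alg_pi0 T)) raddf_sum /=.
  under eq_bigr => i _ do rewrite alg_piZ linearZ /= fX -alg_piZ.
  rewrite -(big_morph _ (piD S) (alg_pi0 S)); congr (alg_pi S _).
  under eq_bigr => i _ do rewrite scaler_sumr.
  rewrite exchange_big; apply: eq_bigr => j _ /=.
  by rewrite mxE scaler_suml; apply: eq_bigr => i _; rewrite mxE scalerA.
exists G; split.
  rewrite -row_free_unit -kermx_eq0; apply/eqP/row_matrixP => i.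
  set v := row i (kermx G).
  have vG : v *m G = 0 by rewrite -row_mul mulmx_ker row0.
  have fv : f (alg_pi T (lin v)) = f 0.
    rewrite fL vG raddf0 /lin big1 ?alg_pi0 // => j _.
    by rewrite mxE scale0r.
  have /alg_pi_eq0 lv := bij_inj bijf fv.
  rewrite row0; apply/rowP => j.
  by rewrite -gradient_lin (relations_gradient j lowT lv) mxE.
move=> i; set d := row i _ *m G; set t := row i T *m G.
have : lin d * lin d - lin t * lin t \in relations S.
  apply/alg_pi_eq0.
  have <- : f (alg_pi T (4%:R *: relator T i)) =
      alg_pi S (lin d * lin d - lin t * lin t).
    rewrite relator_squares // !alg_piD !alg_piN !alg_piM -!fL.
    by rewrite rmorphB !rmorphM.
  rewrite alg_piZ.
  suff -> : alg_pi T (relator T i) = 0 by rewrite scaler0 raddf0.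
  apply/alg_pi_eq0/relationsP; exists (fun k => (k == i)%:R).
  rewrite (bigD1 i) //= eqxx mul1r big1 ?addr0 // => k /negPf->.
  by rewrite mul0r.
(* A relator is a quarter of a difference of squares, whence [c k / 4]; the Hessian of a square
   brings the factor 2. *)
move=> /(relations_hessian lowS)[c cP]; exists (fun k => c k / 4%:R) => p q.
have four0 : 4%:R != 0 :> F by rewrite (natrM _ 2 2) mulf_neq0.
apply: (mulfI two0).
have hB (a b : {mpoly F[n]}) :
    hessian p q (a - b) = hessian p q a - hessian p q b.
  by rewrite /hessian !mderivB mevalB.
have hZ k (a : {mpoly F[n]}) : hessian p q (k *: a) = k * hessian p q a.
  by rewrite /hessian !mderivZ mevalZ.
transitivity (hessian p q (lin d * lin d - lin t * lin t)).
  by rewrite hB !hessian_lin; ring.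
rewrite cP mulr_sumr; apply: eq_bigr => k _; apply: (mulfI four0).
rewrite mulrCA -hZ relator_squares // hB !hessian_lin !mxE.
by field; exact: four0.
Qed.

(** * Passage to the coordinates over the [D_k], and conclusion *)

(* The coordinates over the [D_k] of the forms [L_k] that [T] defines. *)
Definition cay (F : fieldType) (n : nat) (T : 'M[F]_n) : 'M[F]_n :=
  T *m invmx (2%:R%:M - T).

Lemma cay_unit (F : fieldType) (n : nat) (T : 'M[F]_n) :
  2%:R != 0 :> F -> strictly_lower T -> 2%:R%:M - T \in unitmx.
Proof.
move=> two0 lowT; apply: strictly_lower_unit => // i j ij.
by rewrite mxE lowT // oppr0.
Qed.

Lemma strictly_lower_cay (F : fieldType) (n : nat) (T : 'M[F]_n) :
  2%:R != 0 :> F -> strictly_lower T -> strictly_lower (cay T).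
Proof.
move=> two0 lowT; apply: (@strictly_lower_div _ _ 2%:R _ (- T) T) => //.
  by move=> i j ij; rewrite mxE lowT // oppr0.
by rewrite /cay mulmxKV // cay_unit.
Qed.

(** Writing 1 as [(2 - T) (2 - T)^-1] gives [1 + cay T = 2 (2 - T)^-1], hence
    [T (1 + cay T) = 2 cay T]. *)
Lemma cayK (F : fieldType) (n : nat) (T : 'M[F]_n) :
  2%:R != 0 :> F -> strictly_lower T -> tri (cay T) = T.
Proof.
move=> two0 lowT; apply/esym/tri_eq; first exact: strictly_lower_cay.
have uT := cay_unit two0 lowT.
rewrite -{1}(mulmxV uT) -mulmxDl subrK mul_scalar_mx.
by rewrite -scalemxAr.
Qed.

Lemma related_cay (F : fieldType) (n : nat) (T S G : 'M[F]_n) :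
  2%:R != 0 :> F -> strictly_lower T -> strictly_lower S ->
  (forall i, exists c : 'I_n -> F, forall p q,
    let d := row i (2%:R%:M - T) *m G in let t := row i T *m G in
    d 0 p * d 0 q - t 0 p * t 0 q =
    \sum_k c k * ((2%:R%:M - S) k p * (2%:R%:M - S) k q - S k p * S k q)) ->
  related (cay T) ((2%:R%:M - T) *m G *m invmx (2%:R%:M - S)) (cay S).
Proof.
move=> two0 lowT lowS iso i; have [c Ec] := iso i; exists c.
have uT := cay_unit two0 lowT; have uS := cay_unit two0 lowS.
set N := invmx (2%:R%:M - S).
(* [sq u] is the symmetric matrix of the square of the form [u], kept opaque; multiplying by [N^T]
   and [N] rewrites it over the [D_k] of [S]. *)
have [sq sqB sqN] : exists2 sq : 'rV[F]_n -> 'M[F]_n,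
    forall u v p q, (sq u - sq v) p q = u 0 p * u 0 q - v 0 p * v 0 q &
    forall u, N^T *m sq u *m N = sq (u *m N).
  exists (fun u => u^T *m u) => [u v p q|u]; last by rewrite trmx_mul !mulmxA.
  by rewrite !mxE !big_ord1 !mxE.
have E : sq (row i (2%:R%:M - T) *m G) - sq (row i T *m G) =
    \sum_k c k *: (sq (row k (2%:R%:M - S)) - sq (row k S)).
  apply/matrixP => p q; rewrite summxE sqB Ec; apply: eq_bigr => k _.
  by rewrite [RHS]mxE sqB ![row k _ _ _]mxE.
have {}E : sq (row i (2%:R%:M - T) *m G *m N) - sq (row i T *m G *m N) =
    \sum_k c k *: (sq (delta_mx 0 k) - sq (row k (cay S))).
  rewrite -!sqN -mulmxBl -mulmxBr E mulmx_sumr mulmx_suml.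
  apply: eq_bigr => k _; rewrite -scalemxAr -scalemxAl mulmxBr mulmxBl !sqN.
  by rewrite -!row_mul mulmxV // row1.
have LB : cay T *m ((2%:R%:M - T) *m G *m N) = T *m G *m N.
  by rewrite /cay !mulmxA mulmxKV.
move=> p q; move: E => /matrixP/(_ p q); rewrite LB summxE sqB -!row_mul.
rewrite ![row i _ _ _]mxE => ->; apply: eq_bigr => k _.
rewrite [LHS]mxE sqB ![row k _ _ _]mxE ![delta_mx _ _ _ _]mxE.
by rewrite !eqxx !(eq_sym k).
Qed.

Theorem theorem3p8 (F : fieldType) (charF : 2%N \notin [pchar F])
    (T S : 'M[F]_4) (lowT : strictly_lower T) (lowS : strictly_lower S)
    (neqTS : T <> S) (isoTS : graded_iso T S) :
  eto_equiv T S.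
Proof.
have two0 : 2%:R != 0 :> F by move: charF; rewrite !inE.
have [G [uG iso]] := graded_iso_related two0 lowT lowS isoTS.
have lowM := strictly_lower_cay two0 lowS.
(* With [m = 4] the condition [id_from] is vacuous, so the reduction starts from any invertible
   matrix. *)
have [||L' [e lowL' rel]] := reduce_to_1 (m := 4) two0 lowM
  (strictly_lower_cay two0 lowT) _ (related_cay two0 lowT lowS iso).
- by rewrite !unitmx_mul unitmx_inv uG !cay_unit.
- by move=> i k; rewrite (leqNgt 4 i) (leqNgt 4 k) !ltn_ord.
have := leqv_trans e (related_1_leqv two0 lowL' lowM rel).
by rewrite /leqv !cayK.
Qed.
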